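(* Let $(X,\tau,\mathfrak a)$ be an aura topological space. For every $A\subseteq X$, $$\operatorname{cl}_{\mathfrak a}^{\infty}(A)=\mathord{\downarrow}_{\mathfrak a}A.$$ Moreover, $\operatorname{cl}_{\mathfrak a}^{\infty}$ is exactly the ordinary topological closure operator of $(X,\tau_{\mathfrak a})$.
   Context: $X$ is a nonempty set. An aura topological space is a triple $(X,\tau,\mathfrak a)$ where $(X,\tau)$ is a topological space and $\mathfrak a:X\to\tau$ (the scope function) satisfies $x\in\mathfrak a(x)$ for every $x\in X$. A set $U\subseteq X$ is $\mathfrak a$-open if $\{x\in U:\mathfrak a(x)\subseteq U\}=U$; the family of all $\mathfrak a$-open sets is denoted $\tau_{\mathfrak a}$ and is known to be a topology on $X$. For $A\subseteq X$, $\operatorname{cl}_{\mathfrak a}(A)=\{x\in X:\mathfrak a(x)\cap A\neq\varnothing\}$, $\operatorname{cl}_{\mathfrak a}^0(A)=A$, $\operatorname{cl}_{\mathfrak a}^{n+1}(A)=\operatorname{cl}_{\mathfrak a}(\operatorname{cl}_{\mathfrak a}^n(A))$, and $\operatorname{cl}_{\mathfrak a}^{\infty}(A)=\bigcup_{n\ge0}\operatorname{cl}_{\mathfrak a}^n(A)$. The scope relation is $xR_{\mathfrak a}y\iff y\in\mathfrak a(x)$, $\preccurlyeq_{\mathfrak a}$ is its reflexive-transitive closure, and $\mathord{\downarrow}_{\mathfrak a}A=\{x\in X:\exists y\in A,\ x\preccurlyeq_{\mathfrak a}y\}$. *)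

(* Defs.v *)
From Stdlib Require Import Relation_Operators.
From HB Require Import structures.
From mathcomp Require Import all_boot all_order.
From mathcomp Require Import boolp classical_sets topology.

Set Implicit Arguments.
Unset Strict Implicit.
Unset Printing Implicit Defensive.

Local Open Scope classical_set_scope.

Record scope_function (X : topologicalType) := ScopeFunction {
  scope_fun :> X -> set X;
  scope_open : forall x, open (scope_fun x);
  scope_mem : forall x, scope_fun x x
}.

Section Aura.
Context {X : topologicalType} (a : scope_function X).
Implicit Types (A U : set X) (x y : X).

Definition aura_open U : Prop := [set x | U x /\ a x `<=` U] = U.

Definition aura_cl A : set X := [set x | a x `&` A !=set0].

Definition aura_cl_iter (n : nat) A : set X := iter n aura_cl A.

Definition aura_cl_infty A : set X := \bigcup_n aura_cl_iter n A.

Definition scope_rel x y : Prop := a x y.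

Definition scope_preorder : X -> X -> Prop := clos_refl_trans X scope_rel.

Definition scope_down A : set X := [set x | exists2 y, A y & scope_preorder x y].

Lemma aura_openP U : aura_open U <-> forall x, U x -> a x `<=` U.
Proof.
rewrite /aura_open; split=> [UE x|aU]; first by rewrite -{1}UE => -[].
by apply/seteqP; split=> [x []|x Ux] //; split=> //; exact: aU.
Qed.

Lemma aura_openT : aura_open setT.
Proof. by apply/aura_openP. Qed.

Lemma aura_openI : setI_closed aura_open.
Proof.
move=> U V /aura_openP aU /aura_openP aV; apply/aura_openP => x [Ux Vx] y axy.
by split; [exact: aU Ux _ axy | exact: aV Vx _ axy].
Qed.

Lemma aura_open_bigU (I : Type) (F : I -> set X) :
  (forall i, aura_open (F i)) -> aura_open (\bigcup_i F i).
Proof.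
move=> aF; apply/aura_openP => x [i _ Fx] y axy; exists i => //.
by have /aura_openP := aF i; apply; [exact: Fx | exact: axy].
Qed.

End Aura.

(* The set X with the topology of aura_open sets. It is an alias because X
   already carries its own topology as a canonical instance. *)
Definition aura_space (X : topologicalType) (a : scope_function X) : Type := X.

HB.instance Definition _ (X : topologicalType) (a : scope_function X) :=
  Choice.copy (aura_space a) X.
HB.instance Definition _ (X : topologicalType) (a : scope_function X) :=
  isOpenTopological.Build (aura_space a)
    (aura_openT a) (@aura_openI X a) (@aura_open_bigU X a).

Lemma aura_spaceE (X : topologicalType) (a : scope_function X) :
  @open (aura_space a) = @aura_open X a.
Proof. by []. Qed.

(* Main.v *)
Require Import Defs.
From Stdlib Require Import Relation_Operators Operators_Properties.
From mathcomp Require Import all_boot all_order.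
From mathcomp Require Import boolp classical_sets topology.

Local Open Scope classical_set_scope.

(** Applying the one-step closure [n] times to [A] gives the points from which
    [A] can be reached by a chain of exactly [n] scope steps, because
    [aura_cl A] collects the points that have a scope successor in [A]. Taking
    the union over [n] therefore amounts to reaching [A] by some finite chain,
    which is membership in the down-set [scope_down a A].

    The aura-open sets are exactly the up-sets of the scope preorder
    ([aura_open_upward], [aura_open_up]), so the aura topology is the Alexandrov
    topology of that preorder: the up-set generated by [x] is the smallest
    neighbourhood of [x], and [x] is adherent to [A] precisely when this up-set
    meets [A], that is, when [x] lies below a point of [A]. *)

(** The [n = 0] layer of the iteration provides reflexivity and each further
    layer prepends one step, so the chains are matched with the
    left-to-right presentation [clos_refl_trans_1n] of the preorder. *)
Lemma aura_cl_infty_down (X : topologicalType) (a : scope_function X)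
    (A : set X) : aura_cl_infty a A = scope_down a A.
Proof.
apply/seteqP; split=> x.
  case=> n _; elim: n x => [|n IHn] x.
    by move=> Ax; exists x => //; exact: rt_refl.
  case=> z [axz /IHn[y Ay zy]]; exists y => //.
  by apply: rt_trans zy; exact: rt_step.
case=> y Ay /clos_rt_rt1n_iff xy; elim: xy Ay => {x y} [x Ax|x z y axz _ IHz Ay].
  by exists 0%N.
by have [n _ nz] := IHz Ay; exists n.+1 => //; exists z.
Qed.

Lemma aura_open_upward (X : topologicalType) (a : scope_function X)
    (U : set X) (x y : X) : aura_open a U -> scope_preorder a x y -> U x -> U y.
Proof.
move=> /aura_openP aU; elim=> {x y} [x y axy Ux|//|x y z _ IHxy _ IHyz /IHxy//].
exact: aU Ux _ axy.
Qed.

Lemma aura_open_up (X : topologicalType) (a : scope_function X) (x : X) :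
  aura_open a (scope_preorder a x).
Proof.
by apply/aura_openP => y xy z ayz; apply: rt_trans xy _; exact: rt_step.
Qed.

(** A neighbourhood of [x] contains everything above [x], hence meets [A] as
    soon as [x] lies below [A]; conversely it suffices to test adherence on the
    smallest neighbourhood, the up-set generated by [x]. *)
Lemma closure_aura_space (X : topologicalType) (a : scope_function X)
    (A : set X) : @closure (aura_space a) A = scope_down a A.
Proof.
apply/seteqP; split=> x.
  have up_x : @nbhs _ (aura_space a) x (scope_preorder a x).
    by apply: open_nbhs_nbhs; split; [exact: aura_open_up | exact: rt_refl].
  by move=> /(_ _ up_x)[y [Ay xy]]; exists y.
case=> y Ay xy B; rewrite nbhsE => -[U [oU Ux] UB]; exists y; split=> //.
by apply: UB; exact: aura_open_upward oU xy Ux.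
Qed.

Theorem proposition3p3 (X : topologicalType) (X_neq0 : [set: X] !=set0)
    (a : scope_function X) :
  (forall A : set X, aura_cl_infty a A = scope_down a A) /\
  aura_cl_infty a = @closure (aura_space a).
Proof.
split; first exact: aura_cl_infty_down.
by apply/funext => A; rewrite aura_cl_infty_down closure_aura_space.
Qed.
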